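(* Let $n_m=2^{k_0}+2^{k_1}+\cdots+2^{k_m}$ with integers $0\le k_0<k_1<\cdots<k_m$ and $m\ge 0$. If $n_m=4k+2$ for some $k\in\mathbb{N}$, then a minimal set of generators of a Sylow 2-subgroup of the alternating group $A_{n_m}$ has $\sum_{i=1}^{m}k_i$ elements.
   Context: A minimal set of generators means a generating set of smallest possible cardinality (the rank of the group). Note that the sum starts at $i=1$, i.e. $k_0$ is not included. *)

(* Defs.v *)
From mathcomp Require Import all_boot.

(* Main.v *)
Require Import Defs.
From mathcomp Require Import all_boot all_fingroup all_solvable.
From mathcomp Require Import zify.

Set Implicit Arguments.
Unset Strict Implicit.
Unset Printing Implicit Defensive.

(** Since [n] is [2] modulo [4], its lowest binary digit is at [k_0 = 1], and
    [N = n - 2] is the sum of the other [2 ^ k_i]. The 2-parts of [#|'Alt_n|]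
    and of [N`!] agree, and the symmetric group on [N] points embeds in ['Alt_n]:
    act on [N] of the points and swap the two remaining ones exactly when the
    permutation is odd. Hence a Sylow 2-subgroup of ['Alt_n] is isomorphic to a
    Sylow 2-subgroup of the symmetric group on [N] points ([grank_Sylow_Alt]),
    and it remains to show that the rank of the latter is the sum of the
    positions of the binary digits of [N].

    Sylow 2-subgroups [Q] of symmetric groups are built by reading the binary
    expansion of the degree from the top digit down. Each new digit replaces [Q],
    acting on [T], by the wreath product of [C_2] with [Q], acting on [T * bool],
    and a digit 1 also adds a fixed point. Two numbers are
    followed along this recursion ([sylow_data_bits]): the rank of [Q] and the
    number of its orbits, which is the number of digits 1 read so far. The base
    [C_2 ^ T] of the wreath product is generated, under conjugation by [Q], by
    one flip for each orbit of [Q], so doubling the degree increases the rank by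
    the number of orbits. This is also how much the sum of the positions of the
    digits grows, as each digit moves up by one place.

    That no smaller generating set exists is witnessed by a dual family of
    characters: if [g_1, ..., g_d] generate [G] and there are homomorphisms
    [chi_i] from [G] to the group of order 2 with [chi_i (g_j)] nontrivial
    exactly for [i = j], then the [2 ^ d] products of the [chi_i] are distinct,
    whereas a group generated by [r] elements has at most [2 ^ r] such
    homomorphisms ([grank_dual_basis]). For the wreath product the new characters
    count, modulo 2, the flips over a given orbit of [Q]. *)

Local Open Scope group_scope.

(** * Rank from a dual family of characters *)

(** The group of order 2 is [bool] with [addb]. Only the values of [chi i] on [G]
    matter, so the characters are plain functions on the ambient type. *)
Record dual_basis (gT : finGroupType) (G : {set gT}) (I : finType)
    (g : I -> gT) (chi : I -> gT -> bool) : Prop := DualBasis {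
  dual_basis_gen : <<g @: setT>> = G;
  dual_basisM : forall i, {in G &, {morph chi i : x y / x * y >-> x (+) y}};
  dual_basisE : forall i j, chi i (g j) = (i == j)
}.

Lemma dual_basis_mem (gT : finGroupType) (G : {set gT}) (I : finType) g
    (chi : I -> gT -> bool) : dual_basis G g chi -> forall i, g i \in G.
Proof. by move=> b i; rewrite -(dual_basis_gen b) mem_gen ?imset_f. Qed.

Section Character.

Variables (gT : finGroupType) (G : {group gT}) (e : gT -> bool).
Hypothesis eM : {in G &, {morph e : x y / x * y >-> x (+) y}}.

Lemma character1 : e 1 = false.
Proof. by have := eM (group1 G) (group1 G); rewrite mulg1; case: (e 1). Qed.

Lemma character_ker_group_set : group_set [set x in G | ~~ e x].
Proof.
apply/group_setP; split=> [|x y]; first by rewrite inE group1 character1.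
rewrite !inE => /andP[Gx /negPf ex] /andP[Gy /negPf ey].
by rewrite groupM // eM // ex ey.
Qed.

Lemma character_gen (A : {set gT}) :
  <<A>> = G -> {in A, forall x, ~~ e x} -> {in G, forall x, ~~ e x}.
Proof.
move=> genA eA x; rewrite -[in x \in _]genA => Ax.
suff /subsetP/(_ x Ax): <<A>> \subset [set x in G | ~~ e x].
  by rewrite inE => /andP[].
rewrite (gen_subG _ (Group character_ker_group_set)).
by apply/subsetP=> y Ay; rewrite inE -genA mem_gen ?eA.
Qed.

End Character.

(** The generators bound the rank from above. For the other bound, a character is
    determined by the subset of a generating set [A] on which it is nontrivial,
    and the products of the [chi i] over the subsets of [I] are [2 ^ #|I|]
    distinct characters. *)
Lemma grank_dual_basis (gT : finGroupType) (G : {group gT}) (I : finType)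
  g (chi : I -> gT -> bool) : dual_basis G g chi -> 'm(G) = #|I|.
Proof.
move=> b; apply/eqP; rewrite eqn_leq; apply/andP; split.
  rewrite -(dual_basis_gen b); apply: leq_trans (grank_min _) _.
  by rewrite -[#|I|]cardsT leq_imset_card.
have [A genA <-] := grank_witness G.
pose chis (S : {set I}) x := \big[addb/false]_(i in S) chi i x.
have chisM (S : {set I}) : {in G &, {morph chis S : x y / x * y >-> x (+) y}}.
  by move=> x y Gx Gy; rewrite -big_split; apply: eq_bigr => i _;
     apply: (dual_basisM b).
have chisE (S : {set I}) j : chis S (g j) = (j \in S).
  have [Sj|Sj] := boolP (j \in S).
    rewrite /chis (bigD1 j) //= (dual_basisE b) eqxx big1 // => i /andP[_ ij].
    by rewrite (dual_basisE b) (negPf ij).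
  rewrite /chis big1 // => i Si; rewrite (dual_basisE b).
  by apply: contraNF Sj => /eqP <-.
pose F (S : {set I}) := [set x in A | chis S x].
have F_inj : injective F.
  move=> S1 S2 /setP eqF; apply/setP=> j; rewrite -!chisE.
  have eM : {in G &, {morph (fun x => chis S1 x (+) chis S2 x)
                      : x y / x * y >-> x (+) y}}.
    by move=> x y Gx Gy /=; rewrite !chisM // addbACA.
  apply/eqP; rewrite -negb_add.
  apply: (character_gen eM genA) (dual_basis_mem b j) => x Ax.
  by have := eqF x; rewrite !inE Ax /= => ->; rewrite addbb.
have: #|F @: setT| <= #|powerset A|.
  by apply/subset_leq_card/subsetP=> _ /imsetP[S _ ->];
     rewrite powersetE; apply/subsetP=> x; rewrite inE => /andP[].
rewrite card_imset // card_powerset -powersetT card_powerset cardsT.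
by rewrite leq_exp2l.
Qed.

Lemma morphim_dual_basis (aT rT : finGroupType) (G : {group aT})
    (f : {morphism G >-> rT}) (injf : 'injm f) (I : finType)
    g (chi : I -> aT -> bool) :
  dual_basis G g chi ->
  dual_basis (f @* G) (f \o g) (fun i => chi i \o invm injf).
Proof.
move=> b; split.
- have sgG : g @: setT \subset G.
    by apply/subsetP=> _ /imsetP[i _ ->]; apply: dual_basis_mem b i.
  by rewrite imset_comp -morphimEsub // -morphim_gen // (dual_basis_gen b).
- move=> i _ _ /morphimP[x _ Gx ->] /morphimP[y _ Gy ->] /=.
  by rewrite -morphM // !invmE ?groupM // (dual_basisM b).
- by move=> i j /=; rewrite invmE ?(dual_basisE b) // (dual_basis_mem b).
Qed.

(** * Representatives of the orbits *)

(** The type [J] indexes the orbits of [Q]: [lab] sends a point to the index of its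
    orbit, and [rep] picks a point in each orbit. *)
Record orbit_labelling (T J : finType) (Q : {set {perm T}})
    (rep : J -> T) (lab : T -> J) : Prop := OrbitLabelling {
  orbit_labJ : {in Q, forall (q : {perm T}) t, lab (q t) = lab t};
  orbit_repK : cancel rep lab;
  orbit_rep_trans : forall t, exists2 q : {perm T}, q \in Q & q (rep (lab t)) = t
}.

(** * Extending a permutation along an injection *)

Section Extension.

Variables (T U : finType) (f : T -> U).
Hypothesis f_inj : injective f.

Definition ext_fun (s : {perm T}) (y : U) :=
  if [pick x | f x == y] is Some x then f (s x) else y.

Lemma ext_fun_in s x : ext_fun s (f x) = f (s x).
Proof.
by rewrite /ext_fun; case: pickP => [z /eqP/f_inj->|/(_ x)]; rewrite ?eqxx.
Qed.

Lemma ext_fun_out s y : y \notin codom f -> ext_fun s y = y.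
Proof.
move=> f'y; rewrite /ext_fun; case: pickP => // x /eqP fx.
by rewrite -fx codom_f in f'y.
Qed.

Lemma ext_funK s : cancel (ext_fun s) (ext_fun s^-1).
Proof.
move=> y; have [/codomP[x ->]|f'y] := boolP (y \in codom f).
  by rewrite !ext_fun_in permK.
by rewrite !ext_fun_out.
Qed.

Definition ext_perm s : {perm U} := perm (can_inj (ext_funK s)).

Lemma ext_perm_in s x : ext_perm s (f x) = f (s x).
Proof. by rewrite permE ext_fun_in. Qed.

Lemma ext_perm_out s y : y \notin codom f -> ext_perm s y = y.
Proof. by rewrite permE; apply: ext_fun_out. Qed.

Lemma ext_permM : {morph ext_perm : s t / s * t}.
Proof.
move=> s t; apply/permP=> y; rewrite permM.
have [/codomP[x ->]|f'y] := boolP (y \in codom f).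
  by rewrite !ext_perm_in permM.
by rewrite !ext_perm_out.
Qed.

Lemma ext_perm_inj : injective ext_perm.
Proof.
move=> s t /permP eq_st; apply/permP=> x.
by apply: f_inj; rewrite -!ext_perm_in eq_st.
Qed.

End Extension.

(** * The wreath product of C_2 with a permutation group *)

Section Wreath.

Variable T : finType.
Implicit Types (c : {set T}) (q : {perm T}) (x : T * bool).

(** The blocks [{t} * bool] are permuted by [q]; the set [c], an element of the
    base group [C_2 ^ T], tells which blocks are flipped on the way. *)
Definition wr_fun c q x := (q x.1, x.2 (+) (x.1 \in c)).

Lemma wr_fun_inj c q : injective (wr_fun c q).
Proof.
move=> [t b] [t' b'] [/perm_inj <-].
by rewrite /= => /(@addIb _ _ _) <-.
Qed.

Definition wr c q : {perm T * bool} := perm (@wr_fun_inj c q).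

Lemma wrE c q t b : wr c q (t, b) = (q t, b (+) (t \in c)).
Proof. by rewrite permE. Qed.

Lemma wrM c1 q1 c2 q2 :
  wr c1 q1 * wr c2 q2
    = wr [set t | (t \in c1) (+) (q1 t \in c2)] (q1 * q2).
Proof.
by apply/permP=> [[t b]]; rewrite permM !wrE permM inE addbA.
Qed.

Lemma wr1 : wr set0 1 = 1.
Proof. by apply/permP=> [[t b]]; rewrite wrE !perm1 inE addbF. Qed.

(** The projection of the wreath product onto the permutations of the blocks. The
    default [1] is for permutations that do not preserve the blocks. *)
Definition wr_top (s : {perm T * bool}) : {perm T} :=
  insubd (1 : {perm T}) [ffun t => (s (t, false)).1].

Lemma wr_topE c q : wr_top (wr c q) = q.
Proof.
rewrite /wr_top; have ->: [ffun t => (wr c q (t, false)).1] = val q.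
  by apply/ffunP=> t; rewrite ffunE wrE /= pvalE.
exact: valKd.
Qed.

Lemma wr_inj c1 q1 c2 q2 : wr c1 q1 = wr c2 q2 -> c1 = c2 /\ q1 = q2.
Proof.
move=> eq12; split; last by rewrite -(wr_topE c1 q1) eq12 wr_topE.
apply/setP=> t; have /permP/(_ (t, false)) := eq12.
by rewrite !wrE => [[_]].
Qed.

Variable Q : {group {perm T}}.

Definition wreath : {set {perm T * bool}} := wr @2: ([set: {set T}], Q).

Lemma wreathP s :
  reflect (exists c, exists2 q, q \in Q & s = wr c q) (s \in wreath).
Proof.
apply: (iffP imset2P) => [[c q _ Qq ->]|[c [q Qq ->]]]; first by exists c, q.
by exists c q; rewrite ?inE.
Qed.

Lemma mem_wr c q : q \in Q -> wr c q \in wreath.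
Proof. by move=> Qq; apply/wreathP; exists c, q. Qed.

Lemma wreath_group_set : group_set wreath.
Proof.
apply/group_setP; split; first by rewrite -wr1 mem_wr.
move=> _ _ /wreathP[c1 [q1 Q1 ->]] /wreathP[c2 [q2 Q2 ->]].
by rewrite wrM mem_wr ?groupM.
Qed.

Canonical wreath_group := Group wreath_group_set.

Lemma card_wreath : #|wreath| = (2 ^ #|T| * #|Q|)%N.
Proof.
rewrite /wreath curry_imset2X card_imset => [|[c1 q1] [c2 q2] /wr_inj[]]; last first.
  by move=> /= -> ->.
by rewrite cardsX -powersetT card_powerset cardsT.
Qed.

Section WreathData.

Variables (I J : finType) (g : I -> {perm T}) (chi : I -> {perm T} -> bool).
Variables (rep : J -> T) (lab : T -> J).
Hypotheses (bQ : dual_basis Q g chi) (oQ : orbit_labelling Q rep lab).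

Definition wr_gen (k : I + J) : {perm T * bool} :=
  match k with
  | inl i => wr set0 (g i)
  | inr j => wr [set rep j] 1
  end.

Definition wr_char (k : I + J) (s : {perm T * bool}) : bool :=
  match k with
  | inl i => chi i (wr_top s)
  | inr j => \big[addb/false]_(t | lab t == j) (s (t, false)).2
  end.

(** For [k = inr j] the flips of the second factor are counted along the images of
    the orbit [j] under the first one, which permutes this orbit. *)
Lemma wr_charM k : {in wreath &, {morph wr_char k : x y / x * y >-> x (+) y}}.
Proof.
move=> _ _ /wreathP[c1 [q1 Q1 ->]] /wreathP[c2 [q2 Q2 ->]].
case: k => [i|j] /=.
  by rewrite wrM !wr_topE (dual_basisM bQ).
rewrite [X in _ (+) X](reindex_inj (@perm_inj _ q1)) /=.
under [X in _ (+) X]eq_bigl => t do rewrite (orbit_labJ oQ) //.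
by rewrite -big_split; apply: eq_bigr => t _; rewrite wrM !wrE inE.
Qed.

Lemma wr_char_gen k l : wr_char k (wr_gen l) = (k == l).
Proof.
case: k l => [i|j] [i'|j'] /=.
- by rewrite wr_topE (dual_basisE bQ).
- by rewrite wr_topE (character1 (dual_basisM bQ i)).
- by rewrite big1 // => t _; rewrite wrE inE.
rewrite (eq_bigr (fun t => t == rep j')); last by move=> t _; rewrite wrE inE.
have [<-|ne_jj'] := eqVneq j j'.
  rewrite (bigD1 (rep j)) /= ?(orbit_repK oQ) // eqxx big1 => [|t /andP[_ /negPf]] //.
  by rewrite eqxx.
rewrite big1 => [|t /eqP lab_t]; first by apply/esym/eqP => [[/eqP]]; apply/negP.
by apply: contra_neqF ne_jj' => /eqP def_t; rewrite -lab_t def_t (orbit_repK oQ).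
Qed.

(** Conjugating the flip of the representative of an orbit by a copy of [Q] gives the
    flips of all the blocks in that orbit, and these generate the base group. *)
Lemma wr_gen_generates : <<wr_gen @: setT>> = wreath.
Proof.
apply/eqP; rewrite eqEsubset; apply/andP; split.
  rewrite gen_subG; apply/subsetP=> _ /imsetP[[i|j] _ ->] /=; apply: mem_wr => //.
  exact: dual_basis_mem bQ i.
set H := <<_>>.
have Hgen k : wr_gen k \in H by rewrite mem_gen ?imset_f.
have liftM : {in [set: {perm T}] &, {morph (wr set0) : x y / x * y}}.
  by move=> x y _ _; rewrite wrM; congr wr; apply/setP=> t; rewrite !inE.
pose lift := Morphism liftM.
have Htop q : q \in Q -> wr set0 q \in H.
  move=> Qq; have: lift @* Q \subset H.
    rewrite -(dual_basis_gen bQ) morphim_gen ?subsetT //.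
    rewrite gen_subG; apply/subsetP=> _ /morphimP[_ _ /imsetP[i _ ->] ->].
    exact: (Hgen (inl i)).
  by move/subsetP; apply; apply: (mem_morphim lift); rewrite ?inE.
have Hflip t : wr [set t] 1 \in H.
  have [q Qq def_t] := orbit_rep_trans oQ t.
  (* [wr] composes from left to right: unflipped [q^-1] first brings [t] to its
     representative. *)
  have ->: wr [set t] 1 = wr set0 q^-1 * wr [set rep (lab t)] 1 * wr set0 q.
    rewrite !wrM mulg1 mulVg; congr wr; apply/setP=> u; rewrite !inE addbF /=.
    by rewrite -[RHS](inj_eq (@perm_inj _ q)) permKV def_t.
  by rewrite !groupM ?Htop ?groupV // (Hgen (inr _)).
have Hbase c : wr c 1 \in H.
  have [n] := ubnP #|c|; elim: n c => // n IHn c.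
  have [-> _|[t ct] lt_cn] := set_0Vmem c; first by rewrite wr1.
  have ->: wr c 1 = wr [set t] 1 * wr (c :\ t) 1.
    rewrite wrM mulg1; congr wr; apply/setP=> u; rewrite !inE perm1.
    by case: eqP => // ->; rewrite ct.
  by rewrite groupM // IHn // -ltnS (leq_trans _ lt_cn) // ltnS [in leqRHS](cardsD1 t) ct.
apply/subsetP=> _ /wreathP[c [q Qq ->]].
have ->: wr c q = wr c 1 * wr set0 q.
  by rewrite wrM mul1g; congr wr; apply/setP=> t; rewrite !inE addbF.
by rewrite groupM ?Htop.
Qed.

End WreathData.
End Wreath.

Lemma some_inj (T : finType) : injective (@Some T).
Proof. by move=> x y []. Qed.

Section WreathOrbits.

Variables (T J : finType) (Q : {group {perm T}}) (rep : J -> T) (lab : T -> J).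
Hypothesis oQ : orbit_labelling Q rep lab.

Lemma wreath_orbit_labelling :
  orbit_labelling (wreath Q) (fun j => (rep j, false)) (fun x => lab x.1).
Proof.
split=> [_ /wreathP[c [q Qq ->]] [t b]|j|[t b]] /=.
- by rewrite wrE (orbit_labJ oQ).
- exact: orbit_repK oQ j.
have [q Qq def_t] := orbit_rep_trans oQ t.
exists (wr (if b then setT else set0) q); first exact: mem_wr.
by rewrite wrE def_t; case: b; rewrite !inE.
Qed.

(** The added fixed point [None] is an orbit of its own. *)
Lemma option_orbit_labelling :
  orbit_labelling (ext_perm (@some_inj T) @: Q) (omap rep) (omap lab).
Proof.
have ext_None q : ext_perm (@some_inj T) q None = None.
  by rewrite ext_perm_out //; apply/negP=> /codomP[].
split=> [_ /imsetP[q Qq ->] [t|]|[j|]|[t|]] //=.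
- by rewrite ext_perm_in /= (orbit_labJ oQ).
- by rewrite ext_None.
- by rewrite (orbit_repK oQ).
- have [q Qq def_t] := orbit_rep_trans oQ t.
  by exists (ext_perm (@some_inj T) q); rewrite ?imset_f // ext_perm_in def_t.
by exists (ext_perm (@some_inj T) 1); rewrite ?imset_f.
Qed.

End WreathOrbits.

Lemma wreath_dual_basis (T I J : finType) (Q : {group {perm T}}) g
    (chi : I -> {perm T} -> bool) (rep : J -> T) lab :
    dual_basis Q g chi -> orbit_labelling Q rep lab ->
  dual_basis (wreath Q) (wr_gen g rep) (wr_char chi lab).
Proof.
move=> bQ oQ; split; first exact: wr_gen_generates bQ oQ.
  by move=> k; apply: wr_charM bQ oQ k.
by move=> k l; apply: wr_char_gen bQ oQ k l.
Qed.

Section ExtMorphism.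

Variables (T U : finType) (f : T -> U) (f_inj : injective f).
Variable Q : {group {perm T}}.

Definition ext_morphism : {morphism Q >-> {perm U}} :=
  Morphism (in2W (ext_permM f_inj)).

Lemma injm_ext : 'injm ext_morphism.
Proof. by apply/injmP=> s t _ _; apply: ext_perm_inj. Qed.

End ExtMorphism.

(** * Sylow 2-subgroups of symmetric groups *)

Lemma logn2_fact_double N : logn 2 (N.*2)`! = N + logn 2 N`!.
Proof.
elim: N => // N IHN; have coprimeS: coprime 2 N.*2.+1.
  by rewrite coprime2n /= odd_double.
rewrite doubleS !factS !lognM ?muln_gt0 ?fact_gt0 // IHN (logn_coprime coprimeS).
rewrite -doubleS -muln2 lognM // (_ : logn 2 2 = 1%N) //; lia.
Qed.

Lemma logn2_fact_odd N : ~~ odd N -> logn 2 N.+1`! = logn 2 N`!.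
Proof.
move=> evN; rewrite factS lognM ?fact_gt0 // logn_coprime //.
by rewrite coprime2n /= evN.
Qed.

(** A Sylow 2-subgroup [Q] of some symmetric group of degree [N], with [a]
    generators that have a dual family of characters, and with [b] orbits. The set
    of points varies because it is rebuilt at each step of the recursion. *)
Variant sylow_data (N a b : nat) : Prop :=
  SylowData (T I J : finType) (Q : {group {perm T}}) (g : I -> {perm T})
    (chi : I -> {perm T} -> bool) (rep : J -> T) (lab : T -> J) of
    #|T| = N & #|I| = a & #|J| = b & #|Q| = (2 ^ logn 2 N`!)%N
  & dual_basis Q g chi & orbit_labelling Q rep lab.

Lemma sylow_data0 : sylow_data 0 0 0.
Proof.
pose v0 A (x : void) : A := match x with end.
apply: (@SylowData 0 0 0 void void void 1%G (v0 _) (v0 _) (v0 _) (v0 _)).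
- exact: card_void.
- exact: card_void.
- exact: card_void.
- by rewrite cards1.
- split=> [|[]|[]].
  apply/trivgP; rewrite gen_subG; apply/subsetP=> x /imsetP[[]].
- by split=> [q _ []|[]|[]].
Qed.

(** The wreath product has the right order since the 2-part of [(2 * N)`!] is
    [2 ^ N] times that of [N`!]; each orbit of [Q] adds a generator. *)
Lemma sylow_data_double N a b : sylow_data N a b -> sylow_data N.*2 (a + b) b.
Proof.
case=> T I J Q g chi rep lab <- <- <- cardQ bQ oQ.
have bW := wreath_dual_basis bQ oQ; have oW := wreath_orbit_labelling oQ.
apply: (SylowData _ _ _ _ bW oW) => //.
- by rewrite card_prod card_bool muln2.
- by rewrite card_sum.
- by rewrite card_wreath cardQ logn2_fact_double expnD.
Qed.

(** For even [N] the factorials of [N] and of [N + 1] have the same 2-part. *)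
Lemma sylow_dataS N a b : sylow_data N a b -> ~~ odd N -> sylow_data N.+1 a b.+1.
Proof.
case=> T I J Q g chi rep lab <- <- <- cardQ bQ oQ evN.
have inj_e := injm_ext (@some_inj T) Q.
have bE := morphim_dual_basis inj_e bQ.
have oE := option_orbit_labelling oQ.
rewrite -(morphimEdom (ext_morphism (@some_inj T) Q)) in oE.
apply: (SylowData _ _ _ _ bE oE) => //.
- by rewrite card_option.
- by rewrite card_option.
- by rewrite card_injm // cardQ logn2_fact_odd.
Qed.

(** Induction on the number of binary digits [b j]: removing the lowest one shifts
    the others down, which halves the degree and lowers the sum of the positions by
    the number of remaining digits 1. *)
Lemma sylow_data_bits (b : nat -> bool) L :
  sylow_data (\sum_(j < L) b j * 2 ^ j)%N (\sum_(j < L) b j * j)%N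
    (\sum_(j < L) b j)%N.
Proof.
elim: L b => [|L IHL] b; first by rewrite !big_ord0; apply: sylow_data0.
have /sylow_data_double := IHL (b \o succn).
rewrite !big_ord_recl /= muln0 muln1 add0n -big_split /=.
set N2 := double _; set a := (\sum_(j < L) _)%N; set a' := (\sum_(j < L) _ * bump _ _)%N.
have <-: a = a' by apply: eq_bigr => i _; rewrite mulnS addnC.
have <-: N2 = (\sum_(j < L) b (bump 0 j) * 2 ^ bump 0 j)%N.
  by rewrite /N2 -mul2n big_distrr; apply: eq_bigr => i _; rewrite /= expnS mulnCA.
have evN2: ~~ odd N2 by rewrite odd_double.
by case: (b 0) => // /sylow_dataS; apply.
Qed.

(** * Embedding a symmetric group in an alternating group with two more points *)

Section AltEmbedding.

Variables (T U : finType) (f : T -> U) (f_inj : injective f) (u v : U).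
Hypotheses (f'u : u \notin codom f) (f'v : v \notin codom f) (neq_uv : u != v).

(** The swap of the two points [u] and [v] outside the image of [f] corrects the
    sign. *)
Definition alt_ext (s : {perm T}) : {perm U} :=
  ext_perm f_inj s * tperm u v ^+ odd_perm (ext_perm f_inj s).

Lemma ext_tpermC s : commute (ext_perm f_inj s) (tperm u v).
Proof.
apply/esym/commgP/conjg_fixP.
by rewrite tpermJ !ext_perm_out.
Qed.

Lemma alt_extM : {morph alt_ext : s t / s * t}.
Proof.
move=> s t; rewrite /alt_ext ext_permM odd_permM.
have tt: tperm u v * tperm u v = 1 by rewrite tperm2.
rewrite -!mulgA; congr (_ * _); rewrite [in RHS]mulgA.
rewrite -[in RHS](commuteX _ (ext_tpermC t)) -mulgA; congr (_ * _).
by case: (odd_perm _) (odd_perm _) => [] []; rewrite ?expg0 ?expg1 ?mulg1 ?mul1g ?tt.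
Qed.

Lemma alt_ext_even s : alt_ext s \in 'Alt_U.
Proof.
rewrite Alt_even odd_permM; case: (odd_perm (ext_perm f_inj s)) => //=.
  by rewrite expg1 odd_tperm neq_uv.
by rewrite expg0 odd_perm1.
Qed.

Lemma alt_ext_inj : injective alt_ext.
Proof.
have alt_extE s x : alt_ext s (f x) = f (s x).
  rewrite permM ext_perm_in; case: odd_perm; last by rewrite perm1.
  by rewrite tpermD // eq_sym; [apply: (memPn f'u)|apply: (memPn f'v)]; apply: codom_f.
move=> s t /permP eq_st; apply/permP=> x.
by apply: f_inj; rewrite -!alt_extE eq_st.
Qed.

End AltEmbedding.

(** The 2-parts of [(4 * q + 2)`!] and [(4 * q)`!] differ by a factor 2, which is the
    index of the alternating group. *)
Lemma logn2_card_Alt (T : finType) q :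
  #|T| = (4 * q + 2)%N -> logn 2 #|'Alt_T| = logn 2 (4 * q)`!.
Proof.
move=> cardT; have := @card_Alt T; rewrite cardT => /(_ ltac:(lia)).
move/(congr1 (logn 2)); rewrite lognM ?cardG_gt0 // (_ : logn 2 2 = 1%N) //.
have -> : (4 * q + 2)%N = (2 * q).+1.*2 by lia.
rewrite logn2_fact_double logn2_fact_odd ?oddM // => def_v.
have -> : (4 * q)%N = (2 * q).*2 by lia.
by rewrite logn2_fact_double; lia.
Qed.

(** The image of the embedded Sylow 2-subgroup has the order of a Sylow 2-subgroup
    of ['Alt_T], so it is conjugate to [P]. *)
Lemma grank_Sylow_Alt q a b (T : finType) (P : {group {perm T}}) :
    sylow_data (4 * q) a b -> #|T| = (4 * q + 2)%N -> 2.-Sylow('Alt_T) P ->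
  'm(P) = a.
Proof.
case=> T0 I J Q g chi _ _ cardT0 <- _ cardQ bQ _ cardT sylP.
have lt_card k : k < 4 * q + 2 -> k < #|T| by rewrite cardT.
pose pt (k : 'I_(4 * q + 2)) : T := enum_val (cast_ord (esym cardT) k).
have pt_inj : injective pt by apply: inj_comp enum_val_inj (@cast_ord_inj _ _ _).
pose f (x : T0) := pt (lshift 2 (cast_ord cardT0 (enum_rank x))).
have f_inj : injective f by move=> x y /pt_inj/lshift_inj/cast_ord_inj/enum_rank_inj.
have f'pt k : pt (rshift (4 * q) k) \notin codom f.
  by apply/negP=> /codomP[x /pt_inj/eqP]; rewrite eq_rlshift.
pose e := Morphism (in2W (alt_extM f_inj (f'pt ord0) (f'pt ord_max)))
  : {morphism Q >-> {perm T}}.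
have neq01: pt (rshift (4 * q) ord0) != pt (rshift (4 * q) ord_max).
  by rewrite (inj_eq pt_inj) eq_rshift.
have inj_e : 'injm e.
  by apply/injmP=> s t _ _; apply: alt_ext_inj.
have sylQ : 2.-Sylow('Alt_T) (e @* Q).
  rewrite pHallE card_injm // p_part (logn2_card_Alt cardT) cardQ eqxx andbT.
  by apply/subsetP=> _ /morphimP[s _ _ ->]; apply: alt_ext_even.
have [x _ ->] := Sylow_trans sylQ sylP.
rewrite -(isog_grank (conj_isog _ x)) (injm_grank inj_e) //.
exact: grank_dual_basis bQ.
Qed.

Local Close Scope group_scope.

Theorem theorem5 (m : nat) (k : 'I_m.+1 -> nat)
    (k_incr : forall i j : 'I_m.+1, i < j -> k i < k j)
    (n : nat) (n_binary : n = \sum_(i < m.+1) 2 ^ k i)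
    (n_mod4 : exists q : nat, n = 4 * q + 2)
    (P : {group {perm 'I_n}}) (sylP : (2.-Sylow('Alt_('I_n)) P)%g) :
  'm(P)%g = \sum_(i < m.+1 | 0 < i) k i.
Proof.
have [q def_n] := n_mod4.
have k_inj : injective k.
  move=> i j eq_k; apply/val_inj; case: (ltngtP i j) => // /k_incr;
  by rewrite eq_k ltnn.
have k_gt (i : 'I_m.+1) : 0 < i -> k ord0 < k i by move=> i_gt0; apply: k_incr.
(* The other terms are divisible by [2 ^ (k_0 + 1)]: for [k_0 = 0] the number [n]
   would be odd, and for [k_0 >= 2] it would be divisible by 4. *)
have k0 : k ord0 = 1.
  have: 2 ^ (k ord0).+1 %| \sum_(i < m.+1 | 0 < i) 2 ^ k i.
    by apply: dvdn_sum => i /k_gt; apply: dvdn_exp2l.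
  move: def_n; rewrite n_binary (bigD1 ord0) //=.
  rewrite (eq_bigl (fun i : 'I_m.+1 => 0 < i)) => [|i]; last by rewrite lt0n.
  case: (k ord0) => [|[|k0]] // ; rewrite ?expnS.
    by move=> def_n /dvdnP[z def_z]; lia.
  by move=> def_n /dvdnP[z def_z]; lia.
(* The exponents [k_i] with [i > 0] as binary digits, indexed by their positions. *)
pose L := (\max_i k i).+1.
have ltkL i : k i < L by rewrite ltnS leq_bigmax.
pose b (j : nat) := [exists i : 'I_m.+1, (0 < i) && (k i == j)].
have sum_bits (F : nat -> nat) : \sum_(j < L) b j * F j = \sum_(i < m.+1 | 0 < i) F (k i).
  rewrite [RHS](partition_big (fun i => Ordinal (ltkL i)) predT) //=.
  apply: eq_bigr => j _; rewrite /b; case: existsP => [[i /andP[i_gt0 /eqP kij]]|no_i].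
    rewrite mul1n (big_pred1 i) ?kij // => i'; rewrite -val_eqE /= -kij (inj_eq k_inj).
    by case: eqP => [->|]; rewrite ?i_gt0 ?andbF.
  rewrite big1 // => i /andP[i_gt0 /eqP kij]; case: no_i; exists i.
  by rewrite i_gt0 -kij /= eqxx.
have data := sylow_data_bits b L; rewrite (sum_bits (expn 2)) (sum_bits id) in data.
apply: grank_Sylow_Alt sylP; last by rewrite card_ord; exact: def_n.
suff -> : 4 * q = \sum_(i < m.+1 | 0 < i) 2 ^ k i by exact: data.
apply/eqP; rewrite -(eqn_add2r 2) -def_n n_binary (bigD1 ord0) //= k0 addnC eqn_add2r.
by apply/eqP/eq_bigl=> i; rewrite lt0n.
Qed.
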